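(* Let $X$ be a connected finite polyhedron, $n\ge 1$, let $f\colon X\to D_n(X)$ be an $n$-valued map and let $\bar f_i,\bar f'_j\colon\tilde X\to\tilde X$ be two lift-factors of $f$. (a) If $\bar f_i\sim_{lf}\bar f'_j$, then $p\,\mathrm{Fix}(\bar f_i)=p\,\mathrm{Fix}(\bar f'_j)$. (b) If $p\,\mathrm{Fix}(\bar f_i)\cap p\,\mathrm{Fix}(\bar f'_j)\neq\emptyset$, then $\bar f_i\sim_{lf}\bar f'_j$.
   Context: Let $p\colon\tilde X\to X$ be the universal covering space; $\pi_1(X)$ is identified with the group of covering transformations of $p$. $F_n(X)=\{(x_1,\dots,x_n)\in X^n\mid x_i\ne x_j \text{ for } i\ne j\}$ has the subspace topology, and $D_n(X)$, the set of $n$-element subsets of $X$, has the quotient topology as the orbit space of $F_n(X)$ under the symmetric group $\Sigma_n$. An $n$-valued map is a continuous map $f\colon X\to D_n(X)$. The orbit configuration space is $F_n(\tilde X,\pi)=\{(\tilde x_1,\dots,\tilde x_n)\in\tilde X^n\mid \tilde x_i\ne\alpha\tilde x_j \text{ for all } i\neq j,\ \alpha\in\pi_1(X)\}$, with projection $p^n\colon F_n(\tilde X,\pi)\to D_n(X)$, $p^n(\tilde x_1,\dots,\tilde x_n)=\{p(\tilde x_1),\dots,p(\tilde x_n)\}$. A lifting of $f$ is a continuous map $\bar f=(\bar f_1,\dots,\bar f_n)\colon\tilde X\to F_n(\tilde X,\pi)$ with $p^n\circ\bar f=f\circ p$. The coordinate maps $\bar f_i\colon\tilde X\to\tilde X$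 of all liftings of $f$ are called the lift-factors of $f$. Two lift-factors are equivalent, $\bar f_i\sim_{lf}\bar f'_j$, if there is $\gamma\in\pi_1(X)$ with $\bar f_i=\gamma\bar f'_j\gamma^{-1}$. $\mathrm{Fix}(\bar f_i)=\{\tilde x\in\tilde X\mid\bar f_i(\tilde x)=\tilde x\}$. *)

(* Defs.v *)
From HB Require Import structures.
From mathcomp Require Import all_boot all_order all_algebra.
From mathcomp Require Import all_classical all_reals all_analysis.

Set Implicit Arguments.
Unset Strict Implicit.
Unset Printing Implicit Defensive.

Import Order.TTheory GRing.Theory Num.Theory.
Import numFieldNormedType.Exports.
Local Open Scope classical_set_scope.
Local Open Scope card_scope.
Local Open Scope ring_scope.

Definition is_homeomorphism (X Y : topologicalType) (f : X -> Y) : Prop :=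
  exists g : Y -> X,
    [/\ continuous f, continuous g, cancel f g & cancel g f].

(* An abstract simplicial complex with vertices among 'I_m: a family of
   nonempty faces closed under passing to nonempty subsets. *)
Definition simplicial_complex (m : nat) (K : {set {set 'I_m}}) : Prop :=
  finset.set0 \notin K /\
  forall s t : {set 'I_m}, s \in K -> t \subset s -> t != finset.set0 -> t \in K.

(* Barycentric coordinates; the complex is finite, so the subspace topology
   inherited from R^m is the usual topology of the realization. *)
Definition geom_realization (R : realType) (m : nat) (K : {set {set 'I_m}}) :
    set 'rV[R]_m :=
  [set x | [/\ forall i, 0 <= x ord0 i, \sum_i x ord0 i = 1 &
               [set i | x ord0 i != 0]%SET \in K]].
Arguments geom_realization R {m} K.

Definition finite_polyhedron (R : realType) (X : topologicalType) : Prop :=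
  exists (m : nat) (K : {set {set 'I_m}}), simplicial_complex K /\
    exists h : X -> set_type (geom_realization R K), is_homeomorphism h.

Definition is_path (R : realType) (Y : topologicalType) (x y : Y)
    (g : R -> Y) : Prop :=
  [/\ {within `[0, 1], continuous g}, g 0 = x & g 1 = y].

Definition path_homotopic (R : realType) (Y : topologicalType) (x y : Y)
    (g h : R -> Y) : Prop :=
  exists H : R * R -> Y,
    [/\ {within `[0, 1]%classic `*` `[0, 1]%classic, continuous H},
        {in `[0, 1], forall t, H (t, 0) = g t},
        {in `[0, 1], forall t, H (t, 1) = h t},
        {in `[0, 1], forall s, H (0, s) = x} &
        {in `[0, 1], forall s, H (1, s) = y}].

Definition simply_connected (R : realType) (Y : topologicalType) : Prop :=
  [/\ [set: Y] !=set0,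
      forall x y : Y, exists g : R -> Y, is_path x y g &
      forall (x : Y) (g : R -> Y), is_path x x g ->
        path_homotopic x x g (cst x)].

Definition evenly_covered (Y X : topologicalType) (p : Y -> X) (U : set X) :
    Prop :=
  exists (I : Type) (V : I -> set Y),
    [/\ forall i, open (V i),
        trivIset [set: I] V,
        p @^-1` U = \bigcup_i V i &
        forall i, exists2 h : set_type (V i) -> set_type U,
          is_homeomorphism h & forall y, set_val (h y) = p (set_val y)].

Definition is_covering (Y X : topologicalType) (p : Y -> X) : Prop :=
  [/\ continuous p, set_surj [set: Y] [set: X] p &
      forall x : X, exists U : set X, [/\ open U, U x & evenly_covered p U]].

Definition is_universal_covering (R : realType) (Y X : topologicalType)
    (p : Y -> X) : Prop :=
  is_covering p /\ simply_connected R Y.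

(* For the universal covering, these form the group identified with pi_1(X). *)
Record deck (Y X : topologicalType) (p : Y -> X) := Deck {
  deck_fun :> Y -> Y ;
  deck_inv : Y -> Y ;
  deck_continuous : continuous deck_fun ;
  deck_inv_continuous : continuous deck_inv ;
  deck_funK : cancel deck_fun deck_inv ;
  deck_invK : cancel deck_inv deck_fun ;
  deck_proj : forall y, p (deck_fun y) = p y }.

Definition F_conf (n : nat) (X : topologicalType) : set {ptws 'I_n -> X} :=
  [set x | forall i j, i != j -> x i <> x j].
Arguments F_conf n X : clear implicits.

Definition D_conf (n : nat) (X : topologicalType) : Type :=
  set_type [set A : set X | A #= `I_n].

Section D_conf_topology.
Variables (n : nat) (X : topologicalType).

Lemma F_conf_card (x : set_type (F_conf n X)) :
  range (set_val x : 'I_n -> X) \in [set A : set X | A #= `I_n].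
Proof.
have Fx : F_conf n X (set_val x) := set_mem (svalP x).
apply/mem_set => /=.
have xinj : injective (set_val x : 'I_n -> X).
  by move=> i j xij; apply/eqP; apply: contraPT xij => /Fx.
rewrite (card_eqr card_II); apply: inj_card_eq.
by move=> i j _ _; exact: xinj.
Qed.

Definition F_to_D (x : set_type (F_conf n X)) : D_conf n X :=
  exist _ (range (set_val x : 'I_n -> X)) (F_conf_card x).

HB.instance Definition _ := Choice.copy (D_conf n X)
  (set_type [set A : set X | A #= `I_n]).

(* The fibres of F_to_D are the orbits of the symmetric group, so this is the
   orbit space of F_conf with its quotient topology. *)
Definition D_conf_open (U : set (D_conf n X)) : Prop := open (F_to_D @^-1` U).

Let D_conf_openT : D_conf_open setT.
Proof. by rewrite /D_conf_open preimage_setT; exact: openT. Qed.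

Let D_conf_openI : setI_closed D_conf_open.
Proof. by move=> U V; rewrite /D_conf_open preimage_setI; exact: openI. Qed.

Let D_conf_open_bigU (I : Type) (U : I -> set (D_conf n X)) :
  (forall i, D_conf_open (U i)) -> D_conf_open (\bigcup_i U i).
Proof.
move=> Uo; rewrite /D_conf_open preimage_bigcup.
by apply: bigcup_open => i _; exact: Uo.
Qed.

HB.instance Definition _ := isOpenTopological.Build (D_conf n X)
  D_conf_openT D_conf_openI D_conf_open_bigU.

End D_conf_topology.

Section lift_factors.
Variables (n : nat) (Xt X : topologicalType) (p : Xt -> X).

Definition orbit_conf : set {ptws 'I_n -> Xt} :=
  [set x | forall i j, i != j -> forall a : deck p, x i <> a (x j)].

(* p^n, with values seen as subsets of X: that they have n elements depends on
   the deck group acting transitively on the fibres of p. *)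
Definition orbit_proj (x : set_type orbit_conf) : set X :=
  range (fun i : 'I_n => p (set_val x i)).

Definition is_lifting (f : X -> D_conf n X) (fb : Xt -> set_type orbit_conf) :
    Prop :=
  continuous fb /\ forall y, orbit_proj (fb y) = set_val (f (p y)).

Definition is_lift_factor (f : X -> D_conf n X) (g : Xt -> Xt) : Prop :=
  exists2 fb : Xt -> set_type orbit_conf, is_lifting f fb &
    exists i : 'I_n, g = (fun y => set_val (fb y) i).

Definition lf_equiv (g g' : Xt -> Xt) : Prop :=
  exists c : deck p, g = c \o g' \o deck_inv c.

End lift_factors.

Definition Fixset (T : Type) (g : T -> T) : set T := [set y | g y = y].

(* Main.v *)
Require Import Defs.
From mathcomp Require Import all_boot all_order all_algebra.
From mathcomp Require Import all_classical all_reals all_analysis.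
From mathcomp Require Import ring lra.
Import numFieldNormedType.Exports.
Local Open Scope classical_set_scope.

(** Part (a) is conjugation: if g = c g' c^-1 with c a deck transformation, then
    Fix g = c (Fix g'), and c is invisible to the projection p.

    For part (b), let y in Fix g and y' in Fix g' lie over the same point. Deck
    transformations act transitively on the fibres of the universal covering
    ([deck_transitive]), so some c has c y' = y, and then h = c g' c^-1 agrees
    with g at y. Both g and h carry a point z to a point lying over the finite
    set f (p z), and this rigidity forces g = h ([lift_factor_unique]): write
    g as a coordinate of a lifting, g = fb_i. The n maps p fb_k have pairwise
    distinct values, and p h always takes one of these values. If p g = p h at
    a point, this persists nearby, because p h stays away from the other p fb_k,
    and then either g = h near that point or g <> h near that point, since p is
    a covering. If p g <> p h at a point, this persists by separation of X. So
    the agreement set of g and h is open and closed along every path of the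
    path-connected space Xt. That the p fb_k are distinct is again transitivity
    of the deck group.

    Transitivity is proved by continuing along paths in the fibre product of
    Xt with itself over X. Two points (y, z) and (y', z') of it are [linked]
    when a path joins them there. Linking defines the graph of a map: it is
    total by path lifting ([linked_total]), single-valued because a lift of the
    projection of a loop of Xt is a loop ([lift_of_loop], where simple
    connectedness enters through a null-homotopy), and continuous because a
    polyhedron has neighbourhoods joined to their centre by small paths
    ([polyhedron_locally_path_joined]).

    Paths are continuous maps defined on the whole real line, restricted when
    necessary by retracting the line onto a segment. Every open-and-closed
    argument is then an instance of [locally_constant_line]. *)

(** * Clopen arguments and gluing on the real line *)

Section RealLine.
Set Implicit Arguments.
Unset Strict Implicit.
Import Order.TTheory GRing.Theory Num.Theory.
Local Open Scope ring_scope.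
Variable R : realType.
Implicit Types (a b s t : R).

Definition clamp a b t := Num.max a (Num.min t b).

Lemma clamp_continuous a b : continuous (clamp a b).
Proof.
move=> t; apply: (cvg_comp (fun t => (a, Num.min t b)) _ _
  (@max_continuous _ R (a, Num.min t b))).
apply: (cvg_pair (G := nbhs a) (H := nbhs (Num.min t b))).
  exact: cvg_cst.
apply: (cvg_comp (fun t => (t, b)) _ _ (@min_continuous _ R (t, b))).
by apply: (cvg_pair (G := nbhs t) (H := nbhs b)); [exact: cvg_id|exact: cvg_cst].
Qed.

Lemma clamp_itv a b t : a <= b -> a <= clamp a b t <= b.
Proof. by move=> ab; rewrite /clamp le_max lexx ge_max ab ge_min lexx orbT. Qed.

Lemma clamp_id a b t : a <= t <= b -> clamp a b t = t.
Proof. by move=> /andP[/max_r at_ /min_l tb]; rewrite /clamp tb. Qed.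

Lemma glue_continuous (T : topologicalType) (g h : R -> T) a :
  continuous g -> continuous h -> g a = h a ->
  continuous (fun t => if t <= a then g t else h t).
Proof.
move=> gc hc gha t W /=; case: (ltgtP t a) => [ta|at_|->] Wt.
- have := gc t W Wt; rewrite !near_simpl => gW; near=> u.
  have ua : u < a by near: u; exact: lt_nbhsl.
  by rewrite /= (ltW ua); near: u.
- have := hc t W Wt; rewrite !near_simpl => hW; near=> u.
  have ua : a < u by near: u; exact: lt_nbhsr.
  by rewrite /= leNgt ua /=; near: u.
- have := gc a W Wt; rewrite !near_simpl => gW.
  have := hc a W; rewrite -gha => /(_ Wt); rewrite !near_simpl => hW.
  near=> u => /=; case: ifP => _; [by near: u|by near: u].
Unshelve. all: by end_near. Qed.

(** The truth set and its complement are both open, and the line is connected.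
    This is the form in which connectedness enters all later arguments. *)
Lemma locally_constant_line (A : set R) :
  (forall t, \forall u \near t, A u <-> A t) -> forall s t, A s -> A t.
Proof.
move=> Aloc s t As.
have Ao : open A.
  by rewrite openE => u Au; apply: filterS (Aloc u) => v [_]; apply.
have Aco : open (~` A).
  by rewrite openE => u Au; apply: filterS (Aloc u) => v [vu _] /vu.
have /connected_intervalP : is_interval [set: R] by [].
move=> /(_ A) ->//; first by exists s.
  by exists A; rewrite ?setTI.
by exists A; rewrite ?setTI -?openC.
Qed.

End RealLine.

(** * Sheets of a covering *)

Section Sheets.
Set Implicit Arguments.
Unset Strict Implicit.
Variables (Y X : topologicalType) (p : Y -> X).

(** The open set V is one sheet over the evenly covered set U, and s is the
    section of p over U with values in V. The section is a total function on X,
    meaningful only on U, so that it can be composed freely. Openness of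
    [p @^-1` U `\` V], the union of the other sheets, is what makes V closed
    in the preimage of U. *)
Record sheet (U : set X) (V : set Y) (s : X -> Y) : Prop := Sheet {
  sheet_base_open : open U ;
  sheet_open : open V ;
  sheet_rest_open : open (p @^-1` U `\` V) ;
  sheet_sub : V `<=` p @^-1` U ;
  sheet_mem : forall u, U u -> V (s u) ;
  sheet_sectionK : forall u, U u -> p (s u) = u ;
  sheet_projK : forall y, V y -> s (p y) = y ;
  sheet_section_continuous : forall u, U u -> {for u, continuous s} }.

Lemma covering_sheet (x : X) : is_covering p ->
  exists U : set X, [/\ open U, U x & forall y, U (p y) ->
    exists V s, sheet U V s /\ V y].
Proof.
case=> _ _ /(_ x)[U [Uo Ux [I [V [Vo Vtriv UV hV]]]]].
exists U; split=> // y Uy.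
have [i _ Viy] : (\bigcup_i V i) y by rewrite -UV.
have [h [g [hc gc hK gK]] hp] := hV i.
pose u0 : set_type U := exist _ (p y) (mem_set Uy).
pose s u := set_val (g (insubd u0 u)).
have valU u : U u -> set_val (insubd u0 u) = u.
  by move=> Uu; rewrite /set_val /= insubdK//; exact: mem_set.
have pg (u : set_type U) : p (set_val (g u)) = set_val u by rewrite -hp gK.
have VU : V i `<=` p @^-1` U by rewrite UV => z; exists i.
exists (V i), s; split=> //; split=> //.
- have -> : p @^-1` U `\` V i = \bigcup_(j in [set j | j <> i]) V j.
    rewrite UV; apply/seteqP; split=> z /=.
      by move=> [[j _ Vj] nVi]; exists j => //= ji; apply: nVi; rewrite -ji.
    move=> [j /= ji Vj]; split; first by exists j.
    by move=> Vi; apply: ji; apply: Vtriv => //; exists z.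
  by apply: bigcup_open => j _; exact: Vo.
- by move=> u Uu; exact: set_mem (svalP (g (insubd u0 u))).
- by move=> u Uu; rewrite pg valU.
- move=> z Vz; pose z' : set_type (V i) := exist _ z (mem_set Vz).
  rewrite /s -[RHS]/(set_val z'); congr set_val.
  rewrite -[RHS]hK; congr g; apply: val_inj.
  by transitivity (p z); [exact: valU (VU _ Vz)|rewrite -(hp z')].
- move=> u Uu W; rewrite nbhsE => -[W' [W'o W's] W'W].
  have : open (g @^-1` (set_val @^-1` W')).
    by apply: open_comp => [? _|]; [exact: gc|exists W'].
  case=> O Oo OW.
  have OE v : U v -> O v = W' (s v).
    move=> Uv; rewrite -{1}(valU _ Uv).
    exact: (congr1 (fun S : set (set_type U) => S (insubd u0 v)) OW).
  have : nbhs u (O `&` U).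
    apply: open_nbhs_nbhs; split; first exact: openI.
    by split=> //; rewrite OE.
  by apply: filterS => v [Ov Uv] /=; apply: W'W; rewrite -OE.
Qed.

End Sheets.

(** * Lifting paths and families of paths *)

Section Lifting.
Set Implicit Arguments.
Unset Strict Implicit.
Import Order.TTheory GRing.Theory Num.Theory.
Local Open Scope ring_scope.
Variables (R : realType) (Y X : topologicalType) (p : Y -> X).
Hypothesis p_covering : is_covering p.

(** Let V be the sheet containing [g t]. If [h t] is in V too, then near t
    both maps are the section of V applied to their common projection. If not,
    then near t the map h stays in the other sheets while g stays in V. *)
Lemma agreement_locally_constant (T : topologicalType) (g h : T -> Y) (t : T) :
  {for t, continuous g} -> {for t, continuous h} ->
  (\forall u \near t, p (g u) = p (h u)) ->
  \forall u \near t, g u = h u <-> g t = h t.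
Proof.
move=> gc hc pgh; have pght := nbhs_singleton pgh.
have [U [Uo Ugt /(_ _ Ugt)[V [s [sh Vgt]]]]] := covering_sheet (p (g t)) p_covering.
have gV : \forall u \near t, V (g u).
  by apply: gc; apply: open_nbhs_nbhs; split=> //; exact: sheet_open sh.
have sK := sheet_projK sh.
have [Vht|nVht] := pselect (V (h t)).
  have hV : \forall u \near t, V (h u).
    by apply: hc; apply: open_nbhs_nbhs; split=> //; exact: sheet_open sh.
  apply: filterS3 gV hV pgh => u Vgu Vhu pghu.
  by split=> _; [rewrite -(sK _ Vgt) pght sK|rewrite -(sK _ Vgu) pghu sK].
have hW : \forall u \near t, (p @^-1` U `\` V) (h u).
  apply: hc; apply: open_nbhs_nbhs; split; first exact: sheet_rest_open sh.
  by split=> //=; rewrite -pght.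
apply: filterS2 gV hW => u Vgu [_ nVhu].
by split=> gh; exfalso; [apply: nVhu; rewrite -gh|apply: nVht; rewrite -gh].
Qed.

Lemma lift_unique (L M : R -> Y) : continuous L -> continuous M ->
  (forall t, p (L t) = p (M t)) -> forall s, L s = M s -> forall t, L t = M t.
Proof.
move=> Lc Mc LM s Ls t; apply: (@locally_constant_line R (fun t => L t = M t) _ s t Ls) => u.
apply: agreement_locally_constant.
- exact: Lc.
- exact: Mc.
- by near do exact: LM.
Unshelve. all: by end_near. Qed.

Lemma near_itv (t : R) (P : set R) : nbhs t P ->
  exists ab : R * R, [/\ ab.1 < t, t < ab.2 & forall u, ab.1 < u < ab.2 -> P u].
Proof.
move=> /nbhs_ballP[e /= e0 eP]; exists (t - e, t + e); split=> /=; [lra|lra|].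
move=> u /andP[tu ut]; apply: eP; rewrite /ball /= ltr_norml; lra.
Qed.

(** V is open and closed in the preimage of U, so a lift cannot leave it while
    its projection stays in U. *)
Lemma stays_in_sheet (U : set X) (V : set Y) s (L : R -> Y) (a b : R) :
  sheet p U V s -> continuous L -> (forall t, a < t < b -> U (p (L t))) ->
  forall t u, a < t < b -> a < u < b -> V (L t) -> V (L u).
Proof.
move=> sh Lc LU t u tab uab Vt.
(* c retracts the line onto the segment between t and u. *)
pose c := clamp (Num.min t u) (Num.max t u).
have cab v : a < c v < b.
  have := @clamp_itv R (Num.min t u) (Num.max t u) v.
  rewrite -/(c v); case: (leP t u) => tu; lra.
have Lcc : continuous (L \o c).
  by move=> v; apply: continuous_comp; [exact: clamp_continuous|exact: Lc].
have ct : c t = t by apply: clamp_id; rewrite ge_min le_max !lexx.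
have cu : c u = u by apply: clamp_id; rewrite ge_min le_max !lexx !orbT.
suff: V (L (c u)) by rewrite cu.
apply: (@locally_constant_line R (fun v => V (L (c v))) _ t u); last by rewrite ct.
move=> v; have [Vv|nVv] := pselect (V (L (c v))).
  have : \forall w \near v, V (L (c w)).
    by apply: (Lcc v); apply: open_nbhs_nbhs; split=> //; exact: sheet_open sh.
  by apply: filterS.
have : \forall w \near v, (p @^-1` U `\` V) (L (c w)).
  apply: (Lcc v); apply: open_nbhs_nbhs; split; first exact: sheet_rest_open sh.
  by split=> //; exact: LU.
by apply: filterS => w [_ nVw].
Qed.

(** The set of times T up to which a lift exists is locally constant in T:
    around T the path stays in one evenly covered set, where a lift is extended
    by the section of a sheet. *)
Lemma path_lifting (ga : R -> X) (y : Y) : continuous ga -> p y = ga 0 ->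
  exists L : R -> Y,
    [/\ continuous L, L 0 = y & forall t, 0 <= t <= 1 -> p (L t) = ga t].
Proof.
move=> gac py.
pose A T := exists L : R -> Y,
  [/\ continuous L, L 0 = y & forall t, 0 <= t <= T -> p (L t) = ga t].
have A0 T : T <= 0 -> A T.
  move=> T0; exists (cst y); split=> //; first exact: cst_continuous.
  by move=> t ?; have -> : t = 0 by lra.
suff: A 1 by [].
apply: (@locally_constant_line R A _ 0); last exact: A0.
move=> T; have [U [Uo UT shU]] := covering_sheet (ga T) p_covering.
have /near_itv[[a b] /= [aT Tb gaU]] : nbhs T (ga @^-1` U).
  by apply: gac; exact: open_nbhs_nbhs.
suff Aab t u : a < t < b -> a < u < b -> A t -> A u.
  near=> t; have tab : a < t < b.
    by apply/andP; split; near: t; [exact: lt_nbhsr|exact: lt_nbhsl].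
  by split; apply: Aab; rewrite ?aT ?Tb.
move=> tab uab At.
have [/A0//|u0] := leP u 0; have [ut|tu] := leP u t.
  by case: At => L [Lc L0 pL]; exists L; split=> // v ?; apply: pL; lra.
(* A negative t may be replaced by 0, which lies between t and u, as A 0 holds. *)
wlog t0 : t tab At tu / 0 <= t.
  move=> hw; have [|t0] := leP 0 t; first exact: (hw t).
  by apply: (hw 0) => //; [lra|exact: A0].
have [L [Lc L0 pL]] := At.
have pLt : p (L t) = ga t by apply: pL; rewrite t0 lexx.
have [|V [s [sh VL]]] := shU (L t); first by rewrite pLt; exact: gaU.
have cab v : a < clamp t u v < b.
  by have := @clamp_itv R t u v (ltW tu); lra.
exists (fun v => if v <= t then L v else s (ga (clamp t u v))); split.
- apply: glue_continuous => //.
    move=> v; apply: (@continuous_comp _ _ _ (clamp t u) (s \o ga)).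
      exact: clamp_continuous.
    apply: continuous_comp; first exact: gac.
    exact: (sheet_section_continuous sh (gaU _ (cab v))).
  by rewrite clamp_id ?lexx ?ltW// -pLt (sheet_projK sh).
- by rewrite t0.
- move=> v /andP[v0 vu]; case: ifPn => [vt|].
    by apply: pL; rewrite v0.
  rewrite -ltNge => tv; rewrite (sheet_sectionK sh); last exact: gaU.
  by rewrite clamp_id// vu ltW.
Unshelve. all: by end_near. Qed.

(** Lifts with a common origin of a continuous family of paths depend
    continuously on the parameter. For a fixed parameter s0, continuity at s0 of
    the value at time t is a property that is locally constant in t: near
    (t, s0) everything projects into one evenly covered set, and the lifts that
    are in a sheet at one time are in this sheet at all nearby times. At time 0
    the value does not depend on the parameter. *)
Lemma lift_family_continuous (y : Y) (H : R * R -> X) (L : R -> R -> Y) :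
  continuous H -> (forall s, continuous (L s)) ->
  (forall s t, p (L s t) = H (t, s)) -> (forall s, L s 0 = y) ->
  forall t, continuous (L^~ t).
Proof.
move=> Hc Lc pL L0 t s0.
apply: (@locally_constant_line R (fun t => {for s0, continuous (L^~ t)}) _ 0); last first.
  have -> : L^~ 0 = cst y by apply/funext.
  exact: cst_continuous.
move=> {}t; have [U [Uo Ut /(_ (L s0 t))]] := covering_sheet (H (t, s0)) p_covering.
rewrite pL => /(_ Ut)[V [s [sh VL]]].
have [[P Q] /= [/near_itv[[a b] /= [at_ tb abP]] Qs0] PQ] :
    nbhs (t, s0) (H @^-1` U).
  by apply: Hc; exact: open_nbhs_nbhs.
have LU s1 u : Q s1 -> a < u < b -> U (p (L s1 u)).
  by move=> ? ?; rewrite pL; apply: PQ; split=> //=; exact: abP.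
have stay s1 u v : Q s1 -> a < u < b -> a < v < b -> V (L s1 u) -> V (L s1 v).
  by move=> Qs1; apply: (stays_in_sheet sh (Lc s1)) => w; exact: LU.
have tab : a < t < b by rewrite at_.
suff Aab u v : a < u < b -> a < v < b ->
    {for s0, continuous (L^~ u)} -> {for s0, continuous (L^~ v)}.
  near=> u; have uab : a < u < b.
    by apply/andP; split; near: u; [exact: lt_nbhsr|exact: lt_nbhsl].
  by split; exact: Aab.
move=> uab vab Luc; have Qs0' := nbhs_singleton Qs0.
have VL' u' : a < u' < b -> V (L s0 u') by move=> ?; exact: (stay s0 t).
have VLu : \forall s1 \near s0, V (L s1 u).
  apply: Luc; apply: open_nbhs_nbhs.
  by split; [exact: sheet_open sh|exact: VL'].
have eqL : \forall s1 \near s0, s (H (v, s1)) = L s1 v.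
  apply: filterS2 VLu Qs0 => s1 VLs1 Qs1.
  by rewrite -pL (sheet_projK sh)//; exact: (stay s1 u).
apply: cvg_trans (near_eq_cvg eqL) _.
rewrite -(nbhs_singleton eqL).
apply: (@continuous_comp _ _ _ (fun s1 => H (v, s1)) s).
  apply: (cvg_comp (fun s1 => (v, s1)) H _ (Hc (v, s0))).
  by apply: (cvg_pair (G := nbhs v) (H := nbhs s0)); [exact: cvg_cst|exact: cvg_id].
apply: (sheet_section_continuous sh); rewrite -pL; exact: LU.
Unshelve. all: by end_near. Qed.

End Lifting.

(** * Transitivity of the deck group *)

Section DeckTransitivity.
Set Implicit Arguments.
Unset Strict Implicit.
Import Order.TTheory GRing.Theory Num.Theory.
Local Open Scope ring_scope.

(** Local path-connectedness in its weak form: the points near x are joined to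
    x by paths inside U, which may leave a smaller neighbourhood of x. *)
Definition locally_path_joined (R : realType) (X : topologicalType) :=
  forall (x : X) (U : set X), open U -> U x -> \forall z \near x,
    exists d : R -> X, [/\ continuous d, d 0 = x, d 1 = z & forall t, U (d t)].

(** Turns data that are continuous on a subset, such as paths and homotopies
    on the unit interval or square, into everywhere continuous maps. *)
Lemma within_continuous_retract (Q S T : topologicalType) (A : set S)
    (g : S -> T) (c : Q -> S) :
  {within A, continuous g} -> continuous c -> (forall q, A (c q)) ->
  continuous (g \o c).
Proof.
move=> gA cc Ac q W /= Wq.
have /subspace_continuousP/(_ _ (Ac q) _ Wq) := gA.
rewrite /within /= !near_simpl => /(cc q) /=; rewrite !near_simpl.
by apply: filterS => u; apply; exact: Ac.
Qed.

Variables (R : realType) (Y X : topologicalType) (p : Y -> X).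
Hypothesis p_universal : is_universal_covering R p.
Hypothesis X_lpj : locally_path_joined R X.

Let p_covering : is_covering p. Proof. by case: p_universal. Qed.
Let p_continuous : continuous p. Proof. by case: p_covering. Qed.

Let c01 := @clamp R 0 1.
Let c01_itv t : 0 <= c01 t <= 1. Proof. exact: clamp_itv. Qed.
Let c01_id t : 0 <= t <= 1 -> c01 t = t. Proof. exact: clamp_id. Qed.
Let c01_0 : c01 0 = 0. Proof. by rewrite c01_id ?lexx ?ler01. Qed.
Let c01_1 : c01 1 = 1. Proof. by rewrite c01_id ?lexx ?ler01. Qed.
Let c01_in t : c01 t \in `[0, 1]. Proof. by rewrite in_itv /= c01_itv. Qed.
Let c01_continuous : continuous c01. Proof. exact: clamp_continuous. Qed.
Let comp_c01 (T : topologicalType) (g : R -> T) :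
  continuous g -> continuous (g \o c01).
Proof. by move=> gc t; apply: continuous_comp; [exact: c01_continuous|exact: gc]. Qed.

(** Existence of a path from (y, z) to (y', z') in the fibre product of Y with
    itself over X, given by its two coordinates. *)
Definition linked (y z y' z' : Y) := exists ga L : R -> Y,
  [/\ continuous ga, continuous L & forall t, p (ga t) = p (L t)] /\
  [/\ ga 0 = y, L 0 = z, ga 1 = y' & L 1 = z'].

Lemma linked_proj y z y' z' : linked y z y' z' -> p y' = p z'.
Proof. by move=> [ga [L [[_ _ gaL] [_ _ <- <-]]]]. Qed.

Lemma linked_swap y z y' z' : linked y z y' z' -> linked z y z' y'.
Proof.
move=> [ga [L [[gac Lc gaL] [ga0 L0 ga1 L1]]]].
by exists L, ga; split; split=> // t; rewrite gaL.
Qed.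

Lemma linked_sym y z y' z' : linked y z y' z' -> linked y' z' y z.
Proof.
move=> [ga [L [[gac Lc gaL] [ga0 L0 ga1 L1]]]].
have rc : continuous (fun t : R => 1 - t).
  by move=> t; apply: cvgB; [exact: cvg_cst|exact: cvg_id].
exists (fun t => ga (1 - t)), (fun t => L (1 - t)).
rewrite !subr0 !subrr; split; split=> // t.
- by apply: continuous_comp; [exact: rc|exact: gac].
- by apply: continuous_comp; [exact: rc|exact: Lc].
Qed.

Lemma linked_trans y z y' z' y'' z'' :
  linked y z y' z' -> linked y' z' y'' z'' -> linked y z y'' z''.
Proof.
move=> [ga [L [[gac Lc gaL] [ga0 L0 ga1 L1]]]].
move=> [gb [M [[gbc Mc gbM] [gb0 M0 gb1 M1]]]].
(* Concatenation at double speed. *)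
pose cat (g h : R -> Y) t := if 2 * t <= 1 then g (2 * t) else h (2 * t - 1).
have catc (g h : R -> Y) :
    continuous g -> continuous h -> g 1 = h 0 -> continuous (cat g h).
  move=> gc hc gh t.
  have -> : cat g h =
    (fun t => if t <= 1 then g t else (fun u => h (u - 1)) t) \o ( *%R 2) by [].
  apply: continuous_comp; first exact: mulrl_continuous.
  apply: glue_continuous => //; last by rewrite subrr.
  move=> u; apply: (@continuous_comp R R Y (fun u => u - 1) h); last exact: hc.
  by apply: cvgB; [exact: cvg_id|exact: cvg_cst].
have cat0 g h : cat g h 0 = g 0 by rewrite /cat mulr0 ler01.
have cat1 g h : cat g h 1 = h 1.
  by rewrite /cat mulr1 ifF; [congr h|apply/negbTE]; lra.
exists (cat ga gb), (cat L M); rewrite !cat0 !cat1; split=> //; split.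
- by apply: catc => //; rewrite ga1.
- by apply: catc => //; rewrite L1.
- by move=> t; rewrite /cat; case: ifP.
Qed.

Lemma linked_total y z y' : p y = p z -> exists z', linked y z y' z'.
Proof.
move=> yz; have [_ [_ /(_ y y')[g [gc g0 g1]] _]] := p_universal.
have gcc : continuous (g \o c01).
  by apply: within_continuous_retract gc _ _ => // t; exact: c01_itv.
have pgc : continuous (p \o (g \o c01)).
  by move=> t; apply: continuous_comp; [exact: gcc|exact: p_continuous].
have [|L [Lc L0 pL]] := path_lifting p_covering pgc (y := z).
  by rewrite /= c01_0 g0.
exists (L 1), (g \o c01), (L \o c01) => /=.
rewrite c01_0 c01_1 g0 g1 L0; split=> //; split=> //; first exact: comp_c01.
by move=> t; rewrite /= pL ?c01_itv//= [c01 (c01 t)]c01_id.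
Qed.

(** A null-homotopy H of the loop ga projects to a homotopy K, whose stages
    are lifted from the common origin [L 0]. The endpoint of these lifts depends
    continuously on the stage and lies over a fixed point, so it is constant. It
    is [L 1] at stage 0, by uniqueness of lifts, and [L 0] at stage 1, where the
    path is constant. *)
Lemma lift_of_loop (ga L : R -> Y) :
  continuous ga -> continuous L -> (forall t, p (ga t) = p (L t)) ->
  ga 0 = ga 1 -> L 0 = L 1.
Proof.
move=> gac Lc gaL ga01.
have [_ [_ _ /(_ (ga 0) ga)]] := p_universal.
case; first by split=> //; exact: continuous_subspaceT.
move=> H [Hc Hga Hcst H0 H1].
pose K (ts : R * R) := p (H (c01 ts.1, c01 ts.2)).
have Kc : continuous K.
  have cc : continuous (fun ts : R * R => (c01 ts.1, c01 ts.2)).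
    move=> ts; apply: (cvg_pair (G := nbhs (c01 ts.1)) (H := nbhs (c01 ts.2))).
      exact: (cvg_comp (@fst R R) c01 cvg_fst (@c01_continuous ts.1)).
    exact: (cvg_comp (@snd R R) c01 cvg_snd (@c01_continuous ts.2)).
  move=> ts; apply: (@continuous_comp _ _ _ _ p); last exact: p_continuous.
  apply: (within_continuous_retract Hc cc) => q.
  by split; exact: c01_itv.
have /choice[M MP] : forall s, exists M : R -> Y,
    [/\ continuous M, M 0 = L 0 & forall t, 0 <= t <= 1 -> p (M t) = K (t, s)].
  move=> s; apply: (path_lifting p_covering (ga := fun t => K (t, s))).
    move=> t; apply: (@continuous_comp _ _ _ (fun t => (t, s)) K); last exact: Kc.
    by apply: (cvg_pair (G := nbhs t) (H := nbhs s)); [exact: cvg_id|exact: cvg_cst].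
  by rewrite -gaL /K /= c01_0 H0.
have cK t s : K (c01 t, s) = K (t, s) by rewrite /K /= [c01 (c01 t)]c01_id.
have Mc s : continuous (M s \o c01) by apply: comp_c01; case: (MP s).
have pM s t : p ((M s \o c01) t) = K (t, s).
  by case: (MP s) => _ _ /= ->; rewrite ?cK ?c01_itv.
have M0 s : (M s \o c01) 0 = L 0 by rewrite /= c01_0; case: (MP s).
have M1c := lift_family_continuous p_covering Kc Mc pM M0 (t := 1).
have M10 : (M 1 \o c01) 1 = (M 0 \o c01) 1.
  apply: (@lift_unique R _ _ p p_covering (fun s => (M s \o c01) 1)
    (cst ((M 0 \o c01) 1)) M1c _ _ 0) => //; first exact: cst_continuous.
  by move=> s; rewrite [RHS]pM pM /K /= c01_1 !H1.
have M0L : (M 0 \o c01) 1 = (L \o c01) 1.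
  apply: (@lift_unique R _ _ p p_covering _ (L \o c01) (Mc 0) _ _ 0).
  - exact: comp_c01.
  - by move=> t; rewrite pM /K /= c01_0 Hga// gaL.
  - by rewrite M0 /= c01_0.
have M1L : (M 1 \o c01) 1 = L 0.
  apply: (@lift_unique R _ _ p p_covering _ (cst (L 0)) (Mc 1) _ _ 0 _ 1).
  - exact: cst_continuous.
  - by move=> t; rewrite pM /K /= c01_1 Hcst// -gaL.
  - by rewrite M0.
by move: M1L; rewrite M10 M0L /= c01_1.
Qed.

Lemma linked_functional y z y' z1 z2 :
  linked y z y' z1 -> linked y z y' z2 -> z1 = z2.
Proof.
move=> /linked_sym l1 l2.
have [ga [L [[gac Lc gaL] [ga0 L0 ga1 L1]]]] := linked_trans l1 l2.
by rewrite -L0 -L1; apply: (lift_of_loop gac Lc gaL); rewrite ga0.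
Qed.

(** Near y', a small path issuing from [p y'] lifts to both sheets through y'
    and z', which continues the link. The endpoint in the second sheet is the
    section applied to the projection, hence close to z'. *)
Lemma linked_near y z y' z' (W : set Y) : linked y z y' z' -> nbhs z' W ->
  \forall u \near y', exists2 v, W v & linked y z u v.
Proof.
move=> yz Wz'; have pyz := linked_proj yz.
have [U [Uo Uy shU]] := covering_sheet (p y') p_covering.
have [V1 [s1 [sh1 V1y]]] := shU _ Uy.
have [|V2 [s2 [sh2 V2z]]] := shU z'; first by rewrite -pyz.
have s1y := sheet_projK sh1 V1y.
have s2z : s2 (p y') = z' by rewrite pyz (sheet_projK sh2).
have : nbhs (p y') (U `&` s2 @^-1` W).
  apply: filterI; first exact: open_nbhs_nbhs.
  by apply: (sheet_section_continuous sh2 Uy); rewrite s2z.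
rewrite nbhsE => -[G [Go Gy] GUW].
have joined := p_continuous (X_lpj Go Gy); rewrite !near_simpl in joined.
have V1n : nbhs y' V1.
  by apply: open_nbhs_nbhs; split=> //; exact: sheet_open sh1.
apply: filterS2 V1n joined => u V1u [d [dc d0 d1 dG]].
have dU t : U (d t) by case: (GUW _ (dG t)).
exists (s2 (p u)); first by rewrite -d1; case: (GUW _ (dG 1)).
apply: linked_trans yz _; exists (s1 \o d), (s2 \o d) => /=.
rewrite d0 d1 s1y s2z (sheet_projK sh1 V1u); split=> //; split.
- move=> t; apply: continuous_comp; first exact: dc.
  exact: (sheet_section_continuous sh1 (dU t)).
- move=> t; apply: continuous_comp; first exact: dc.
  exact: (sheet_section_continuous sh2 (dU t)).
- by move=> t; rewrite (sheet_sectionK sh1)// (sheet_sectionK sh2).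
Qed.

Lemma linked_function y z : p y = p z ->
  exists2 c : Y -> Y, continuous c & forall u, linked y z u (c u).
Proof.
move=> yz; have /choice[c cP] : forall u, exists v, linked y z u v.
  by move=> u; exact: linked_total.
exists c => // u W Wcu; have := linked_near (cP u) Wcu.
by rewrite near_simpl; apply: filterS => v [w Ww l] /=;
  rewrite (linked_functional (cP v) l).
Qed.

(** Continuing the pair (y, z) along paths defines a continuous map c, and
    continuing (z, y) defines its inverse, since links can be read with the two
    coordinates exchanged. *)
Lemma deck_transitive (y z : Y) : p y = p z -> exists c : deck p, c y = z.
Proof.
move=> yz; have [c cc cP] := linked_function yz.
have [d dc dP] := linked_function (esym yz).
have cK : cancel c d.
  by move=> u; apply: linked_functional (dP (c u)) _; exact/linked_swap/cP.
have dK : cancel d c.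
  by move=> u; apply: linked_functional (cP (d u)) _; exact/linked_swap/dP.
have pc u : p (c u) = p u by rewrite (linked_proj (cP u)).
exists (Deck cc dc cK dK pc) => /=; apply: (linked_functional (cP y)).
by exists (cst y), (cst z); split; split=> //; exact: cst_continuous.
Qed.

End DeckTransitivity.

(** * Local structure of polyhedra *)

Section Polyhedra.
Set Implicit Arguments.
Unset Strict Implicit.
Import Order.TTheory GRing.Theory Num.Theory.
Local Open Scope ring_scope.
Variable R : realType.

(** Under the hypothesis on supports, the whole segment from v to w is carried
    by the face that carries w. *)
Lemma geom_realization_segment m (K : {set {set 'I_m}}) (v w : 'rV[R]_m) c :
  simplicial_complex K -> geom_realization R K v -> geom_realization R K w ->
  (forall i, v ord0 i != 0 -> w ord0 i != 0) -> 0 <= c <= 1 ->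
  geom_realization R K (v + c *: (w - v)).
Proof.
move=> [_ Kdown] [v0 v1 _] [w0 w1 Kw] vw c01.
have sum1 : \sum_i (v + c *: (w - v)) ord0 i = 1.
  under eq_bigr do rewrite !mxE.
  by rewrite big_split /= -mulr_sumr big_split /= sumrN v1 w1 subrr mulr0 addr0.
split=> //.
  move=> i; rewrite !mxE.
  have -> : v ord0 i + c * (w ord0 i - v ord0 i) =
    (1 - c) * v ord0 i + c * w ord0 i by ring.
  by rewrite addr_ge0// mulr_ge0//; lra.
apply: (Kdown _ _ Kw).
  apply/fintype.subsetP => i; rewrite !inE !mxE; apply: contraNN => /eqP wi.
  have vi : v ord0 i = 0 by apply/eqP; apply: contraT => /vw; rewrite wi eqxx.
  by rewrite wi vi subrr mulr0 addr0.
apply/negP => /eqP supp0; have := oner_neq0 R; rewrite -sum1 big1 ?eqxx// => i _.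
apply/eqP; apply: contraT => wi.
by move: supp0 => /finset.setP/(_ i); rewrite !inE wi.
Qed.

(** A point close to x in the realization has all the nonzero coordinates of
    x, so it is joined to x by a straight segment of the realization, and balls
    are star-shaped about their centre. *)
Lemma polyhedron_locally_path_joined (X : topologicalType) :
  finite_polyhedron R X -> locally_path_joined R X.
Proof.
move=> [m [K [Kc [F [G [Fc Gc FK GK]]]]]] x U Uo Ux.
have [W Wo WU] : open (G @^-1` U) by apply: open_comp => // ? _; exact: Gc.
pose E (z : X) : 'rV[R]_m := set_val (F z).
have Ec : continuous E.
  by move=> z; apply: continuous_comp; [exact: Fc|exact: initial_continuous].
have EK z : geom_realization R K (E z) := set_mem (svalP (F z)).
have WE (q : set_type (geom_realization R K)) : W (set_val q) = U (G q).
  exact: (congr1 (fun S : set (set_type (geom_realization R K)) => S q) WU).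
have : nbhs (E x) W by apply: open_nbhs_nbhs; split=> //; rewrite /E WE FK.
move=> /nbhs_ballP[e /= e0 eW].
have near_ball : \forall z \near x, ball (E x) e (E z).
  by apply: Ec; exact: nbhsx_ballx.
have near_supp : \forall z \near x, forall i, E x ord0 i != 0 -> E z ord0 i != 0.
  apply: filter_forall => i; have [xi|xi] := eqVneq (E x ord0 i) 0.
    by near=> z.
  have Eic : {for x, continuous (fun z => E z ord0 i)}.
    exact: (cvg_comp E (fun v : 'rV[R]_m => v ord0 i) (@Ec x)
      (@coord_continuous _ _ _ ord0 i (E x))).
  have Ei : \forall z \near x, E z ord0 i != 0 by exact: (cvgr_neq0 _ Eic xi).
  by apply: filterS Ei => z zi _.
apply: filterS2 near_ball near_supp => z ballz suppz.
pose w t := E x + clamp 0 1 t *: (E z - E x).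
have c01 t : 0 <= clamp 0 1 t <= (1 : R) by exact: clamp_itv.
have wK t : geom_realization R K (w t) by exact: geom_realization_segment.
have wc : continuous w.
  move=> t; apply: cvgD; first exact: cvg_cst.
  by apply: cvgZr_tmp; exact: clamp_continuous.
pose wK' t : set_type (geom_realization R K) := exist _ (w t) (mem_set (wK t)).
have wK'c : continuous wK' by apply: continuous_comp_initial; exact: wc.
exists (G \o wK'); split=> [t||  |t] /=.
- by apply: continuous_comp; [exact: wK'c|exact: Gc].
- rewrite -[RHS]FK; congr G; apply: val_inj; rewrite /= /w clamp_id ?lexx ?ler01//.
  by rewrite scale0r addr0.
- rewrite -[RHS]FK; congr G; apply: val_inj; rewrite /= /w clamp_id ?lexx ?ler01//.
  by rewrite scale1r addrC subrK.
- rewrite -WE; apply: eW; move: ballz; rewrite /= -!ball_normE /= /w opprD addNKr normrN normrZ.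
  rewrite distrC => lte; apply: le_lt_trans lte.
  have /andP[c0 c1] := c01 t; rewrite ger0_norm//.
  by rewrite ler_piMl.
Unshelve. all: by end_near. Qed.

(** Separation of X, obtained from its embedding in a normed space: the
    difference of the images is nonzero at t, hence near t. *)
Lemma polyhedron_near_neq (X T : topologicalType) (g h : T -> X) (t : T) :
  finite_polyhedron R X -> {for t, continuous g} -> {for t, continuous h} ->
  g t <> h t -> \forall u \near t, g u <> h u.
Proof.
move=> [m [K [_ [F [G [Fc _ FK _]]]]]] gc hc gh.
pose E (z : X) : 'rV[R]_m := set_val (F z).
have Ec : continuous E.
  by move=> z; apply: continuous_comp; [exact: Fc|exact: initial_continuous].
have Einj : injective E by move=> y z /val_inj/(can_inj FK).
have Egc : {for t, continuous (E \o g)} by exact: continuous_comp gc (@Ec _).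
have Ehc : {for t, continuous (E \o h)} by exact: continuous_comp hc (@Ec _).
have Egh : E (g t) - E (h t) != 0 by rewrite subr_eq0; apply/eqP => /Einj.
have near_neq : \forall u \near t, E (g u) - E (h u) != 0.
  exact: (cvgr_neq0 _ (cvgB Egc Ehc) Egh).
by apply: filterS near_neq => u /eqP + ghu; apply; rewrite /= ghu subrr.
Qed.

End Polyhedra.

(** * Rigidity of lift-factors *)

Section LiftFactors.
Set Implicit Arguments.
Unset Strict Implicit.
Import Order.TTheory GRing.Theory Num.Theory.
Variables (R : realType) (X Xt : topologicalType) (p : Xt -> X) (n : nat).
Variable f : X -> D_conf n X.
Hypothesis X_polyhedron : finite_polyhedron R X.
Hypothesis p_universal : is_universal_covering R p.

Let p_continuous : continuous p. Proof. by case: p_universal => -[]. Qed.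

Lemma lifting_coord_continuous (fb : Xt -> set_type (orbit_conf p (n := n))) i :
  continuous fb -> continuous (fun y => set_val (fb y) i).
Proof.
move=> fbc y; apply: (@continuous_comp _ _ _ (set_val \o fb)
  (fun x : {ptws 'I_n -> Xt} => x i)); last exact: (@proj_continuous 'I_n (fun=> Xt) i).
by apply: continuous_comp; [exact: fbc|exact: initial_continuous].
Qed.

(** Points with the same projection are related by a deck transformation,
    which the orbit configuration space excludes for distinct indices. *)
Lemma orbit_conf_proj_inj (x : set_type (orbit_conf p (n := n))) i k :
  p (set_val x i) = p (set_val x k) -> i = k.
Proof.
move=> pik; apply/eqP; apply: contraT => ik.
have lpj := polyhedron_locally_path_joined X_polyhedron.
have [c cik] := deck_transitive p_universal lpj (esym pik).
by exfalso; apply: (set_mem (svalP x) i k ik c); exact: esym cik.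
Qed.

Lemma lift_factor_continuous g : is_lift_factor p f g -> continuous g.
Proof. by move=> [fb [fbc _] [i ->]]; exact: lifting_coord_continuous. Qed.

Lemma lift_factor_value g y : is_lift_factor p f g -> set_val (f (p y)) (p (g y)).
Proof. by move=> [fb [_ <-] [i ->]]; exists i. Qed.

(** With g the coordinate i of the lifting fb, the point [p (h z)] is one of
    the [p (fb z k)]. Near y it differs from those with k <> i, since at y it
    equals [p (fb y i)]. *)
Lemma lift_factor_near_eq g h y : is_lift_factor p f g -> continuous h ->
  (forall z, set_val (f (p z)) (p (h z))) -> p (g y) = p (h y) ->
  \forall z \near y, p (g z) = p (h z).
Proof.
move=> [fb [fbc fbf] [i ->]] hc hf gh.
have : \forall z \near y, forall k, k != i -> p (set_val (fb z) k) <> p (h z).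
  apply: filter_forall => k; have [->|ki] := eqVneq k i; first by near=> z.
  have pk : p (set_val (fb y) k) <> p (h y).
    by rewrite -gh => /orbit_conf_proj_inj /eqP; rewrite (negbTE ki).
  have kc : {for y, continuous (p \o (fun z => set_val (fb z) k))}.
    apply: continuous_comp; last exact: p_continuous.
    exact: lifting_coord_continuous.
  have hc' : {for y, continuous (p \o h)}.
    by apply: continuous_comp; [exact: hc|exact: p_continuous].
  have near_k := polyhedron_near_neq X_polyhedron kc hc' pk.
  by apply: filterS near_k => z ? _.
apply: filterS => z zk; have := hf z; rewrite -fbf => -[k _ /= pk].
by have [<-//|/zk/(_ pk)] := eqVneq k i.
Unshelve. all: by end_near. Qed.

(** Along a path issuing from y, agreement of g and h is a locally constant
    property. *)
Lemma lift_factor_unique g h y : is_lift_factor p f g -> continuous h ->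
  (forall z, set_val (f (p z)) (p (h z))) -> g y = h y -> g = h.
Proof.
move=> gf hc hf ghy; apply/funext => z.
have [p_cov [_ /(_ y z)[ga [gac ga0 ga1]] _]] := p_universal.
pose d := ga \o clamp 0 1.
have dc : continuous d.
  apply: within_continuous_retract gac _ _; first exact: clamp_continuous.
  by move=> t; apply: clamp_itv; exact: ler01.
have d0 : d 0%R = y by rewrite /d /= clamp_id ?ga0// lexx ler01.
have d1 : d 1%R = z by rewrite /d /= clamp_id ?ga1// lexx ler01.
rewrite -d1; apply: (@locally_constant_line R (fun t => g (d t) = h (d t)) _ 0%R).
  move=> t; suff : \forall u \near d t, g u = h u <-> g (d t) = h (d t) by exact: dc.
  have gc := lift_factor_continuous gf.
  have [pgh|pgh] := pselect (p (g (d t)) = p (h (d t))).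
    apply: (agreement_locally_constant p_cov); [exact: gc|exact: hc|].
    exact: lift_factor_near_eq.
  have : \forall u \near d t, p (g u) <> p (h u).
    apply: (polyhedron_near_neq X_polyhedron (g := p \o g) (h := p \o h)) => //.
      by apply: continuous_comp; [exact: gc|exact: p_continuous].
    by apply: continuous_comp; [exact: hc|exact: p_continuous].
  by apply: filterS => u pghu; split=> E; exfalso; [apply: pghu|apply: pgh]; rewrite E.
by rewrite d0.
Qed.

End LiftFactors.

(** * Fixed points and conjugation by deck transformations *)

Section DeckConjugation.
Variables (Xt X : topologicalType) (p : Xt -> X).

Lemma deck_inv_proj (c : deck p) y : p (deck_inv c y) = p y.
Proof. by rewrite -(deck_proj c) deck_invK. Qed.

Lemma proj_Fixset_conj (c : deck p) (g : Xt -> Xt) :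
  p @` Fixset (c \o g \o deck_inv c) = p @` Fixset g.
Proof.
apply/seteqP; split=> _ [y gy <-].
  exists (deck_inv c y); last exact: deck_inv_proj.
  by rewrite /Fixset /= -{2}gy /= deck_funK.
exists (c y); last exact: deck_proj.
by rewrite /Fixset /= deck_funK gy.
Qed.

End DeckConjugation.

Theorem theorem2p9 (R : realType) (X Xt : topologicalType) (p : Xt -> X)
    (n : nat) (f : X -> D_conf n X) (g g' : Xt -> Xt) :
  finite_polyhedron R X ->
  connected [set: X] ->
  is_universal_covering R p ->
  (1 <= n)%N ->
  continuous f ->
  is_lift_factor p f g ->
  is_lift_factor p f g' ->
  (lf_equiv p g g' -> p @` Fixset g = p @` Fixset g') /\
  ((p @` Fixset g) `&` (p @` Fixset g') !=set0 -> lf_equiv p g g').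
Proof.
move=> X_poly _ p_univ _ _ gf g'f; split.
  by move=> [c ->]; exact: proj_Fixset_conj.
move=> [_ [[y gy <-] [y' g'y' py']]].
have lpj := polyhedron_locally_path_joined X_poly.
have [c cy'] := deck_transitive p_univ lpj py'.
exists c; apply: (lift_factor_unique X_poly p_univ (y := y) gf).
- move=> z; apply: (@continuous_comp _ _ _ (deck_inv c) (c \o g')).
    exact: deck_inv_continuous.
  apply: (@continuous_comp _ _ _ g' c); last exact: deck_continuous.
  exact: (lift_factor_continuous g'f).
- move=> z; rewrite /= deck_proj -(deck_inv_proj c z).
  exact: (lift_factor_value (deck_inv c z) g'f).
- by rewrite /= -cy' deck_funK g'y' cy'.
Qed.
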